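(* Let $\sigma(x)=2\Phi(x)-1$ be the probit activation. Then for all $\mu\in\mathbb R$ and $\nu\ge 0$, $$M_\sigma(\mu;\nu)=\sigma\!\left(\frac{\mu}{\sqrt{1+\nu}}\right).$$
   Context: $\Phi$ is the standard normal cumulative distribution function. $M_\sigma(\mu;\nu):=\mathbb E\,\sigma(X)$ where $X\sim\mathcal N(\mu,\nu)$ ($\nu$ is the variance). *)

(* Defs.v *)
From HB Require Import structures.
From mathcomp Require Import all_boot all_order all_algebra.
From mathcomp Require Import all_classical all_reals all_analysis measurable_realfun.
Set Implicit Arguments.
Unset Strict Implicit.
Unset Printing Implicit Defensive.
Import Order.TTheory GRing.Theory Num.Theory.
Local Open Scope classical_set_scope.
Local Open Scope ring_scope.

(* The second argument is the variance.  [normal_prob] takes the standard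
   deviation, and its value at standard deviation 0 is the uniform law on
   [0, 1], so the degenerate normal law has to be given separately. *)
Definition gaussian (R : realType) (mu nu : R) :
    probability (measurableTypeR R) R :=
  if nu == 0 then (dirac (mu : measurableTypeR R) : probability (measurableTypeR R) R)
  else (normal_prob mu (Num.sqrt nu) : probability (measurableTypeR R) R).

(* M_sigma(mu; nu) = E sigma(X) for X ~ N(mu, nu), with X realised as the
   identity on the line; see [gaussian_mean_RV] for an arbitrary X. *)
Definition gaussian_mean (R : realType) (sigma : R -> R) (mu nu : R) : \bar R :=
  ('E_(gaussian mu nu)[sigma])%E.

Lemma gaussian_mean_RV (R : realType) (d : measure_display)
    (T : measurableType d) (P : probability T R)
    (X : {RV P >-> measurableTypeR R}) (sigma : R -> R) (mu nu : R) :
  measurable_fun [set: measurableTypeR R] sigma ->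
  (forall A : set (measurableTypeR R), measurable A ->
     distribution P X A = gaussian mu nu A) ->
  ('E_P[sigma \o X])%E = gaussian_mean sigma mu nu.
Proof.
move=> msigma lawX; rewrite /gaussian_mean unlock.
pose f : measurableTypeR R -> \bar R := fun x => (sigma x)%:E.
have mf : measurable_fun [set: measurableTypeR R] f by exact/measurable_EFinP.
transitivity (\int[distribution P X]_x f x)%E; last first.
  by apply: eq_measure_integral => A mA _; exact: lawX.
rewrite [LHS]integralE [RHS]integralE.
rewrite (ge0_integral_distribution X (measurable_funepos mf) (funepos_ge0 f)).
rewrite (ge0_integral_distribution X (measurable_funeneg mf) (funeneg_ge0 f)).
by congr (_ - _)%E; apply: eq_integral => x _;
  rewrite /= ?funeposE ?funenegE.
Qed.

Definition real_id (R : realType) : measurableTypeR R -> R := idfun.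

HB.instance Definition _ (R : realType) :=
  @isMeasurableFun.Build _ _ _ _ (@real_id R) (@measurable_id _ _ setT).

Definition std_normal_cdf (R : realType) (x : R) : R :=
  fine (cdf (@real_id R : {RV gaussian 0 1 >-> R}) x).

Definition probit (R : realType) (x : R) : R := 2 * std_normal_cdf x - 1.

(* Main.v *)
(* Write s^2 = nu and t^2 = 1 + nu. Substituting z = x + w in Phi(x), the
   integral of phi over z <= x, gives
     E Phi(X) = int_x int_{w <= 0} p_{mu,s}(x) phi(x + w) dw dx.
   Completing the square in x splits p_{mu,s}(x) phi(x + w) into the density
   of N(-mu, t^2) at w times a normal density in x, so after exchanging the
   integrals only P(N(-mu, t^2) <= 0) = Phi(mu / t) is left. *)
Require Import Defs.
From HB Require Import structures.
From mathcomp Require Import all_boot all_order all_algebra.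
From mathcomp Require Import all_classical all_reals all_analysis measurable_realfun.
From mathcomp Require Import ring.
Import Order.TTheory GRing.Theory Num.Theory.
Import numFieldNormedType.Exports.
Local Open Scope classical_set_scope.
Local Open Scope ring_scope.

(** For independent X ~ N(mu, s^2) and standard normal Z, both sides are the joint density of X and
    W = Z - X. The right side factors it as the law of W times the conditional law of X given W =
    w. *)
Lemma normal_pdf_shift_mul (R : realType) (mu s t x w : R) :
  0 < s -> 0 < t -> t ^+ 2 = 1 + s ^+ 2 ->
  normal_pdf mu s x * normal_pdf 0 1 (x + w) =
  normal_pdf (- mu) t w *
    normal_pdf ((mu - s ^+ 2 * w) / t ^+ 2) (s / t) x.
Proof.
move=> s0 t0 ts.
have sn0 : s != 0 by rewrite gt_eqF.
have tn0 : t != 0 by rewrite gt_eqF.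
rewrite !normal_pdfE ?oner_neq0 ?mulf_neq0 ?invr_neq0//.
(* Peaks are matched with peaks, where s^2 * 1 = t^2 * (s / t)^2, and exponentials with
   exponentials. *)
rewrite mulrACA [RHS]mulrACA; congr (_ * _).
  rewrite /normal_peak -!invfM -!sqrtrM ?mulrn_wge0 ?mulr_ge0 ?pi_ge0 ?invr_ge0 ?ltW//.
  by congr (Num.sqrt _)^-1; field.
rewrite /normal_fun -!expRD; congr expR.
have s2 : 1 + s ^+ 2 != 0 by rewrite -ts sqrf_eq0.
rewrite expr_div_n ts; field.
by rewrite s2 sn0.
Qed.

(** Serves twice: with slope 1 to give the inner integral a fixed domain, and with slope [t^-1] to
    standardise a normal law. *)
Lemma integral_ray_affine (R : realType) (a c b : R) (G : R -> R) :
  0 < a -> continuous G -> (forall x, 0 <= G x) ->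
  (\int[lebesgue_measure]_(x in `]-oo, (a * b + c)%R]) (G x)%:E =
   \int[lebesgue_measure]_(x in `]-oo, b]) (a * G (a * x + c))%:E)%E.
Proof.
move=> a0 cG G0.
pose F x : R := a * x + c.
have dF (x : R) : is_derive x 1 F a.
  rewrite /F; apply: is_derive_eq.
  by rewrite scaler1 addr0.
have F'E : derive1 F = cst a.
  by apply/funext => x; rewrite derive1E; apply: derive_val.
have cF : continuous F.
  by move=> x; apply/differentiable_continuous/derivable1_diffP; have [] := dF x.
rewrite -[a * b + c]/(F b) increasing_ge0_integration_by_substitutionNy//.
- by apply: eq_integral => x _; rewrite F'E /= mulrC.
- by move=> x y _ _ xy; rewrite /F ltrD2r ltr_pM2l.
- by rewrite F'E => x _; exact: cvg_cst.
- by rewrite F'E; exact: is_cvg_cst.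
- by rewrite F'E; exact: cvg_cst.
- split; first by move=> x _; have [] := dF x.
  by apply: cvg_at_left_filter; exact: cF.
- have -> : F = (fun r => (r + c / a) * a)
    by apply/funext => r; rewrite /F mulrDl divfK ?gt_eqF// mulrC.
  by apply: gt0_cvgMlNy => //; exact: cvg_addrr_Ny.
- by apply: continuous_subspaceT.
Qed.

(** The explicit density is a version of the Radon-Nikodym derivative of [normal_prob], so it may
    replace that derivative in the change of variables. *)
Lemma integral_normal_prob (R : realType) (m s : R) (f : R -> \bar R) :
  (normal_prob m s).-integrable [set: R] f ->
  (\int[normal_prob m s]_x f x =
   \int[lebesgue_measure]_x (f x * (normal_pdf m s x)%:E))%E.
Proof.
move=> fi.
rewrite -(Radon_Nikodym_change_of_variables (normal_prob_dominates m s))//=.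
have mf := measurable_int _ fi.
apply: ae_eq_integral => //.
- apply: emeasurable_funM => //; apply: (measurable_int lebesgue_measure).
  by apply: Radon_Nikodym_integrable; exact: normal_prob_dominates.
- apply: emeasurable_funM => //=; apply/measurableT_comp => //=.
  exact: measurable_normal_pdf.
- apply: ae_eqe_mul2l => /=.
  (* The derivative is a chosen [h], known through its integrals over measurable sets. The density
     has the same integrals, hence equals [h] almost everywhere. *)
  rewrite Radon_NikodymE//=; first exact: normal_prob_dominates.
  move=> dom; case: cid => /= h [h1 h2 h3].
  apply: integral_ae_eq => //=.
  + by apply/measurableT_comp => //; exact: measurable_normal_pdf.
  + by move=> E E01 mE; rewrite -h3.
Qed.

Lemma std_normal_cdfE (R : realType) (x : R) :
  ((std_normal_cdf x)%:E =
   \int[lebesgue_measure]_(z in `]-oo, x]) (normal_pdf 0 1 z)%:E)%E.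
Proof.
rewrite /std_normal_cdf fineK ?fin_num_measure//.
by rewrite /cdf /distribution /pushforward /= /gaussian oner_eq0 sqrtr1 /normal_prob /real_id.
Qed.

Lemma integral_std_normal_cdf (R : realType) (mu s t : R) :
  0 < s -> 0 < t -> t ^+ 2 = 1 + s ^+ 2 ->
  (\int[lebesgue_measure]_x
     ((std_normal_cdf x)%:E * (normal_pdf mu s x)%:E) =
   (std_normal_cdf (mu / t))%:E)%E.
Proof.
move=> s0 t0 ts.
pose D : set R := `]-oo, 0]%classic.
(* The indicator of w <= 0 extends the integrand to the whole plane, where Tonelli applies to a
   nonnegative measurable function. *)
pose f (z : R * R) : \bar R :=
  ((normal_pdf mu s z.1 * normal_pdf 0 1 (z.1 + z.2))%:E *
   (\1_D z.2)%:E)%E.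
have cphi : continuous (@normal_pdf R 0 1).
  exact: continuous_normal_pdf (oner_neq0 R).
have mphi m u : measurable_fun [set: R] (@normal_pdf R m u).
  exact: measurable_normal_pdf.
have f0 z : (0 <= f z)%E.
  by rewrite mule_ge0// lee_fin ?mulr_ge0 ?normal_pdf_ge0.
have mf : measurable_fun [set: R * R] f.
  apply: emeasurable_funM; apply/measurable_EFinP.
    apply: measurable_funM; first exact: measurableT_comp.
    apply: (measurableT_comp (mphi 0 1)).
    by apply: measurable_funD.
  apply: measurableT_comp; last exact: measurable_snd.
  by apply: measurable_indic; exact: measurable_itv.
transitivity (\int[lebesgue_measure]_x \int[lebesgue_measure]_w f (x, w))%E.
  apply: eq_integral => x _.
  (* The endpoint x is read as 1 * 0 + x, for the substitution z = w + x. *)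
  rewrite std_normal_cdfE -[x in `]-oo, x]]add0r -{1}(mulr0 1).
  rewrite integral_ray_affine//; last by move=> y; exact: normal_pdf_ge0.
  rewrite muleC -ge0_integralZl//; last 3 first.
  - apply/measurable_EFinP/measurable_funTS/measurable_funM => //.
    apply: (measurableT_comp (mphi 0 1)).
    by apply: measurable_funD => //; exact: measurable_funM.
  - by move=> w _; rewrite lee_fin mul1r normal_pdf_ge0.
  - by rewrite lee_fin normal_pdf_ge0.
  rewrite integral_mkcond epatch_indic.
  by apply: eq_integral => w _; rewrite /f /= !mul1r addrC.
etransitivity.
  exact: (@fubini_tonelli _ _ _ _ _ lebesgue_measure lebesgue_measure f mf f0).
transitivity (\int[lebesgue_measure]_(w in D) (normal_pdf (- mu) t w)%:E)%E.
  rewrite [RHS]integral_mkcond epatch_indic.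
  apply: eq_integral => w _.
  rewrite /f /=.
  under eq_integral => x _ do
    rewrite (normal_pdf_shift_mul _ _ _ _ _ _ s0 t0 ts) muleC EFinM muleA.
  rewrite ge0_integralZl//.
  - by rewrite integral_normal_pdf mule1 muleC.
  - by apply/measurable_EFinP; exact: mphi.
  - by move=> x _; rewrite lee_fin normal_pdf_ge0.
  - by rewrite -EFinM lee_fin mulr_ge0 ?normal_pdf_ge0.
rewrite std_normal_cdfE.
(* The endpoint is read as [t^-1] * 0 + mu / t: the substitution z = (w + mu) / t standardises
   N(-mu, t^2). *)
rewrite -[mu / t]add0r -[X in X + mu / t](mulr0 t^-1).
rewrite integral_ray_affine ?invr_gt0//; last by move=> x; exact: normal_pdf_ge0.
apply: eq_integral => w _; congr EFin.
rewrite !normal_pdfE ?oner_neq0 ?gt_eqF// mulrA; congr (_ * _).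
  rewrite /normal_peak -mulrnAr sqrtrM ?sqr_ge0// sqrtr_sqr gtr0_norm// invfM.
  by rewrite expr1n mul1r.
rewrite /normal_fun; congr expR; field.
by rewrite gt_eqF.
Qed.

(** A distribution function is measurable with values in [0, 1]. The measure is left arbitrary to
    cover the Dirac and the normal laws together. *)
Lemma std_normal_cdf_integrable (R : realType)
    (P : probability (measurableTypeR R) R) :
  P.-integrable [set: R] (EFin \o @std_normal_cdf R).
Proof.
apply: measurable_bounded_integrable => //.
- exact: le_lt_trans (probability_le1 P measurableT) (ltry 1).
- have : measurable_fun [set: R] (EFin \o @std_normal_cdf R).
    rewrite (_ : _ \o _ = cdf (@real_id R : {RV gaussian 0 1 >-> R})).
      exact: cdf_measurable.
    by apply/funext => x /=; rewrite /std_normal_cdf fineK// fin_num_measure.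
  by move/measurable_EFinP.
- exists 1; split => // y y1 x _ /=.
  rewrite (le_trans _ (ltW y1))// ger0_norm /std_normal_cdf ?fine_ge0//.
  by rewrite -lee_fin fineK ?fin_num_measure// cdf_le1.
Qed.

Theorem lemmaC1 (R : realType) (mu nu : R) (hnu : 0 <= nu) :
  gaussian_mean (@probit R) mu nu = (probit (mu / Num.sqrt (1 + nu)))%:E.
Proof.
rewrite /gaussian_mean unlock.
under eq_integral do rewrite /probit EFinB EFinM.
have ip (P : probability (measurableTypeR R) R) := std_normal_cdf_integrable R P.
rewrite integralB//; last 2 first.
- exact: (integrableZl measurableT 2 (ip _)).
- exact: finite_measure_integrable_cst.
rewrite (integralZl measurableT (ip _)).
have -> : (\int[gaussian mu nu]_x 1%:E = 1%:E :> \bar R)%E.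
  by rewrite (integral_cst _ measurableT) mul1e [LHS]probability_setT.
rewrite /probit EFinB EFinM; congr (_ * _ - _)%E.
rewrite /gaussian; have [->|nu0] := eqVneq nu 0.
  rewrite integral_dirac ?diracT ?mul1e ?addr0 ?sqrtr1 ?divr1//.
  (* Evaluation at a Dirac mass asks for measurability, which integrability against any one
     probability provides. *)
  exact: measurable_int _ (ip (gaussian 0 1)).
have nugt0 : 0 < nu by rewrite lt_neqAle eq_sym nu0.
rewrite integral_normal_prob//.
(* Here s is the square root of nu and t that of 1 + nu. *)
apply: integral_std_normal_cdf; rewrite ?sqrtr_gt0 ?addr_gt0//.
by rewrite !sqr_sqrtr ?addr_ge0.
Qed.
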